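(* Let $T$ be a text of length $n$ whose last character is a sentinel that occurs nowhere else in $T$ and is lexicographically smallest. Let $1\le s\le e\le n$, $S:=T[s\ldots e]$, $i:=\mathit{ISA}[s]$ and $j:=\mathit{LF}[i]$. Then $(s,e)$ is a net occurrence if and only if $|S|=\ell(i)$ and $|S|\ge\ell(j)$.
   Context: $T_k=T[k\ldots n]$. The suffix array $\mathit{SA}$ lists starting positions of suffixes in lexicographic order; $\mathit{ISA}$ is its inverse ($\mathit{ISA}[k]=i$ iff $\mathit{SA}[i]=k$). $\mathit{LF}[i]=\mathit{ISA}[\mathit{SA}[i]-1]$ if $\mathit{SA}[i]>1$ and $\mathit{LF}[i]=1$ if $\mathit{SA}[i]=1$. $\mathit{LCP}[i]$ ($2\le i\le n$) is the length of the longest common prefix of $T_{\mathit{SA}[i-1]}$ and $T_{\mathit{SA}[i]}$, with $\mathit{LCP}[1]=\mathit{LCP}[n+1]=0$; $\ell(i)=\max(\mathit{LCP}[i],\mathit{LCP}[i+1])$ for $i\in[n]$. With $f(W)$ the number of occurrences of $W$ in $T$, an occurrence $(s,e)$ is a net occurrence if $f(T[s\ldots e])\ge 2$, $f(T[s-1\ldots e])=1$ and $f(T[s\ldots e+1])=1$, where the second condition is considered true when $s=1$ and the third when $e=n$. *)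

(* Defs.v *)
From mathcomp Require Import all_boot all_order.

Set Implicit Arguments.
Unset Strict Implicit.
Unset Printing Implicit Defensive.

Import Order.TTheory.

(* Texts are sequences, but all positions and array indices below are 1-based:
   a text T has positions 1, ..., size T. *)

Section Texts.

Variables (d : Order.disp_t) (A : orderType d).
Implicit Types (T W u v : seq A) (s e i k : nat).

Definition substr T s e : seq A := take (e.+1 - s) (drop s.-1 T).

Definition suf T k : seq A := substr T k (size T).

Definition has_sentinel T : Prop :=
  exists (w : seq A) (c : A),
    [/\ T = rcons w c, c \notin w & forall x, x \in T -> (c <= x)%O].

(* The order on seqlexi A is the lexicographic one. *)
Definition suf_le T : rel nat :=
  fun k l => ((suf T k : seqlexi A) <= (suf T l : seqlexi A))%O.

Definition SA_seq T : seq nat := sort (suf_le T) (iota 1 (size T)).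

Definition SA T i : nat := nth 0 (SA_seq T) i.-1.

Definition ISA T k : nat := (index k (SA_seq T)).+1.

Definition LF T i : nat := if 1 < SA T i then ISA T (SA T i).-1 else 1.

Fixpoint lcp u v : nat :=
  match u, v with
  | x :: u', y :: v' => if x == y then (lcp u' v').+1 else 0
  | _, _ => 0
  end.

Definition LCP T i : nat :=
  if 2 <= i <= size T then lcp (suf T (SA T i.-1)) (suf T (SA T i)) else 0.

Definition ell T i : nat := maxn (LCP T i) (LCP T i.+1).

(* Only meant for nonempty W. *)
Definition freq T W : nat :=
  count (fun k => prefix W (suf T k)) (iota 1 (size T)).

Definition net_occurrence T s e : Prop :=
  [/\ 1 <= s <= e /\ e <= size T,
      2 <= freq T (substr T s e),
      s = 1 \/ freq T (substr T s.-1 e) = 1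
    & e = size T \/ freq T (substr T s e.+1) = 1].

Lemma mem_SA_seq T k : (k \in SA_seq T) = (1 <= k <= size T).
Proof. by rewrite mem_sort mem_iota add1n ltnS. Qed.

Lemma SA_seq_sorted T : sorted (suf_le T) (SA_seq T).
Proof. by apply: sort_sorted => k l; apply: le_total. Qed.

Lemma ISA_SA T i k : 1 <= i <= size T -> 1 <= k <= size T ->
  ISA T k = i <-> SA T i = k.
Proof.
have sz : size (SA_seq T) = size T by rewrite size_sort size_iota.
have un : uniq (SA_seq T) by rewrite sort_uniq iota_uniq.
case: i => // i /= hi; rewrite -mem_SA_seq => hk; rewrite /ISA /SA /=.
by split=> [[<-]|<-]; rewrite ?nth_index ?index_uniq ?sz.
Qed.

End Texts.

(* Main.v *)
Require Import Defs.
From mathcomp Require Import all_boot all_order.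
From mathcomp Require Import zify.

(** For a suffix starting at [k], the lexicographic order puts the suffixes
    sharing a given prefix with it in a contiguous block around it, so the
    prefix of length [m >= 1] repeats in the text iff it is shared with a
    neighbour of [k] in the suffix array, i.e. iff [m <= ell (ISA k)].  The
    three conditions on frequencies of a net occurrence are instances of this
    equivalence: at [ISA s] for lengths [|S|] and [|S| + 1], and at
    [ISA (s - 1) = LF (ISA s)] for length [|S| + 1].  When [s = 1] the last
    index is 1 instead, where [ell] vanishes because of the sentinel. *)

Import Order.TTheory.

Section Texts.

Set Implicit Arguments.
Unset Strict Implicit.

(** Deleting the known witness [k] lowers the count by exactly one, and since [r] has no duplicates,
    whatever is still counted differs from [k]. *)
Lemma count_gt1P (I : eqType) (P : pred I) (r : seq I) (k : I) :
    uniq r -> k \in r -> P k ->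
  reflect (exists l, [/\ l \in r, l != k & P l]) (1 < count P r).
Proof.
move=> ur kr Pk.
have -> : (1 < count P r) = has P (rem k r).
  rewrite has_count count_rem kr Pk /=; lia.
apply: (iffP hasP) => [[l]|[l [lr lk Pl]]].
  by rewrite mem_rem_uniq // inE => /andP[lk lr] Pl; exists l.
by exists l => //; rewrite mem_rem_uniq // inE lk.
Qed.

Variables (d : Order.disp_t) (A : orderType d).
Implicit Types (T W u v w : seq A) (s e i k m : nat).

Lemma lcpC u v : lcp u v = lcp v u.
Proof.
elim: u v => [|x u IH] [|y v] //=.
by rewrite eq_sym; case: eqP => // _; rewrite IH.
Qed.

(** The bound on [m] makes [take m u] have length exactly [m]. *)
Lemma leq_lcp m u v : m <= size u -> (m <= lcp u v) = prefix (take m u) v.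
Proof.
elim: u m v => [|x u IH] [|m] v //=; rewrite ?prefix0s //.
case: v => [|y v] //= mu.
by case: eqP => //= _; rewrite ltnS IH.
Qed.

Lemma lcp_leq_size u v : lcp u v <= size u.
Proof. by elim: u v => [|x u IH] [|y v] //=; case: eqP => // _; apply: IH. Qed.

(** This is the contiguity of blocks in the suffix array. The head of [v] is squeezed between two
    equal heads, so both lexicographic comparisons pass to the tails. *)
Lemma prefix_between W (u v w : seqlexi A) :
  (u <= v)%O -> (v <= w)%O -> prefix W u -> prefix W w -> prefix W v.
Proof.
elim: W u v w => [|x W IH] [|a u] [|b v] [|c w] //.
rewrite !Order.SeqLexiOrder.Exports.lexi_cons !prefix_cons.
move=> /andP[ab uv] /andP[bc vw] /andP[/eqP xa Wu] /andP[/eqP xc Ww].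
have xb : x = b by apply/le_anti; rewrite {1}xa ab xc bc.
move: uv vw; rewrite -xa -xb -xc lexx eqxx /= => uv vw.
exact: IH uv vw Wu Ww.
Qed.

Lemma suf_drop T k : 1 <= k -> suf T k = drop k.-1 T.
Proof.
by case: k => // k _; rewrite /suf /substr /= subSS take_oversize // size_drop.
Qed.

Lemma size_suf T k : 1 <= k -> size (suf T k) = (size T).+1 - k.
Proof. move=> k1; rewrite suf_drop // size_drop; lia. Qed.

Lemma substr_suf T s e : 1 <= s -> substr T s e = take (e.+1 - s) (suf T s).
Proof. by move=> s1; rewrite suf_drop. Qed.

Lemma size_SA_seq T : size (SA_seq T) = size T.
Proof. by rewrite size_sort size_iota. Qed.

Lemma SA_seq_uniq T : uniq (SA_seq T).
Proof. by rewrite sort_uniq iota_uniq. Qed.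

Lemma SA_ISA T k : 1 <= k <= size T -> SA T (ISA T k) = k.
Proof. by rewrite -mem_SA_seq => hk; rewrite /SA /ISA nth_index. Qed.

Lemma ISA_bounds T k : 1 <= k <= size T -> 1 <= ISA T k <= size T.
Proof. by rewrite -mem_SA_seq -index_mem size_SA_seq. Qed.

Lemma SA_bounds T i : 1 <= i <= size T -> 1 <= SA T i <= size T.
Proof.
by move=> hi; rewrite -mem_SA_seq mem_nth // size_SA_seq; lia.
Qed.

Lemma ISAK T i : 1 <= i <= size T -> ISA T (SA T i) = i.
Proof. by move=> hi; apply/(ISA_SA hi (SA_bounds hi)). Qed.

Lemma suf_SA_le T i1 i2 : 1 <= i1 -> i1 <= i2 -> i2 <= size T ->
  ((suf T (SA T i1) : seqlexi A) <= (suf T (SA T i2) : seqlexi A))%O.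
Proof.
move=> h1 h12 h2.
apply: (sorted_leq_nth (leT := suf_le T) _ _ 0 (SA_seq_sorted T)).
- by move=> x y z; apply: le_trans.
- by move=> x; apply: lexx.
- by rewrite inE size_SA_seq; lia.
- by rewrite inE size_SA_seq; lia.
- by lia.
Qed.

Lemma freq_gt1P T W k : 1 <= k <= size T -> prefix W (suf T k) ->
  reflect (exists l, [/\ 1 <= l <= size T, l != k & prefix W (suf T l)])
          (1 < freq T W).
Proof.
have memE l : (l \in iota 1 (size T)) = (1 <= l <= size T).
  by rewrite mem_iota add1n ltnS.
move=> hk Wk; apply: (iffP (count_gt1P (iota_uniq _ _) _ Wk)).
- by rewrite memE.
- by case=> l []; rewrite memE => *; exists l.
- by case=> l [*]; exists l; rewrite memE.
Qed.

Lemma leq_ell T k m : 1 <= k <= size T -> 1 <= m <= size (suf T k) ->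
  (m <= ell T (ISA T k)) = (1 < freq T (take m (suf T k))).
Proof.
move=> hk /andP[m1 mk]; have := ISA_bounds hk; have := SA_ISA hk.
set i := ISA T k => SAi hi.
have neq i' : 1 <= i' <= size T -> i' <> i -> SA T i' != k.
  by move=> hi' ne; apply/eqP => E; apply: ne; rewrite /i -E ISAK.
(* Symmetry puts the suffix at [k] first in both terms, so that [leq_lcp] speaks of its prefix of
   length [m]. *)
rewrite leq_max /LCP SAi /= [lcp (suf T (SA T i.-1)) _]lcpC.
apply/idP/(freq_gt1P hk (prefix_take _ _)).
(* A missing neighbour gives the default [LCP] value 0, which is below [m]. *)
- case/orP; case: ifP => [hi'|_]; try by rewrite leqNgt m1.
  + rewrite leq_lcp // => pre; exists (SA T i.-1).
    by split=> //; [apply: SA_bounds | apply: neq]; lia.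
  + rewrite leq_lcp // => pre; exists (SA T i.+1).
    by split=> //; [apply: SA_bounds | apply: neq]; lia.
- case=> l [hl lk pre].
  have := ISA_bounds hl; have := SA_ISA hl; set i' := ISA T l => SAi' hi'.
  have ne : i' <> i by move=> E; move: lk; rewrite -SAi' E SAi eqxx.
  have prek := prefix_take (suf T k) m.
  (* The neighbour of [i] on the side of [i'] lies between the two, possibly at [i'] itself, and so
     inherits the shared prefix. *)
  case: (ltnP i' i) => ii'; apply/orP; [left|right].
  + have -> : 1 < i <= size T by lia.
    rewrite leq_lcp //.
    apply: (prefix_between (u := suf T l) (w := suf T k)) => //.
    * by rewrite -SAi'; apply: suf_SA_le; lia.
    * by rewrite -SAi; apply: suf_SA_le; lia.
  + have -> : i < size T by lia.
    rewrite leq_lcp //.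
    apply: (prefix_between (u := suf T k) (w := suf T l)) => //.
    * by rewrite -SAi; apply: suf_SA_le; lia.
    * by rewrite -SAi'; apply: suf_SA_le; lia.
Qed.

(** This serves the case [e = size T], where no extension to the right exists. *)
Lemma ell_ISA_leq_size T k : 1 <= k <= size T ->
  ell T (ISA T k) <= size (suf T k).
Proof.
move=> hk; rewrite geq_max /LCP /= SA_ISA //.
by rewrite lcpC; do 2?case: ifP => // _; rewrite ?lcp_leq_size.
Qed.

Lemma freq_gt0 T k W : 1 <= k <= size T -> prefix W (suf T k) -> 0 < freq T W.
Proof.
move=> hk Wk; rewrite -has_count; apply/hasP; exists k => //.
by rewrite mem_iota add1n ltnS.
Qed.

Lemma freq1 T c : freq T [:: c] = count_mem c T.
Proof.
(* Counting from 0 turns [suf] into a plain [drop], which suits induction on [T]. *)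
rewrite /freq (iotaDl 1 0) count_map.
under eq_count => k do rewrite /= suf_drop // add1n /=.
elim: T => //= x T IH; rewrite prefix0s andbT eq_sym.
by congr addn; rewrite (iotaDl 1 0) count_map -IH.
Qed.

(** The least suffix is at most the suffix [[:: c]], so by minimality of [c] it starts with [c]. As
    [c] occurs once, already its prefix of length 1 does not repeat. *)
Lemma ell1 T : has_sentinel T -> ell T 1 = 0.
Proof.
case=> w [c [defT cw cmin]].
have sT : size T = (size w).+1 by rewrite defT size_rcons.
have h1 : 1 <= 1 <= size T by rewrite sT.
have := SA_bounds h1; have := ISAK h1; have := @suf_SA_le T 1 _ isT.
set k := SA T 1 => kmin Ik hk.
have sk : 0 < size (suf T k) by rewrite size_suf; lia.
have hn : 1 <= size T <= size T by rewrite sT leqnn.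
have lastE : suf T (size T) = [:: c].
  by rewrite suf_drop ?sT //= defT -cats1 drop_size_cat.
have := kmin _ (proj1 (andP (ISA_bounds hn))) (proj2 (andP (ISA_bounds hn))).
rewrite SA_ISA // lastE.
have: head c (suf T k) \in T.
  apply: (@mem_drop k.-1 _ T); rewrite -suf_drop; last by lia.
  by case: (suf T k) sk => //= x u _; rewrite mem_head.
case E: (suf T k) sk => [|x u] //= _ /cmin cx.
rewrite Order.SeqLexiOrder.Exports.lexi_cons => /andP[xc _].
have xE : x = c by apply/le_anti; rewrite xc cx.
have := @leq_ell T k 1 hk; rewrite Ik E xE /= take0 freq1 => /(_ isT) ell1E.
apply/eqP; rewrite -leqn0 leqNgt ell1E.
by rewrite defT -cats1 count_cat /= eqxx (count_memPn cw).
Qed.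

End Texts.

Theorem theorem15 (d : Order.disp_t) (A : orderType d) (T : seq A)
    (hT : has_sentinel T) (s e : nat)
    (hs : 1 <= s) (hse : s <= e) (he : e <= size T) :
  let S := substr T s e in
  let i := ISA T s in
  let j := LF T i in
  net_occurrence T s e <-> size S = ell T i /\ ell T j <= size S.
Proof.
move=> S i j.
have hsT : 1 <= s <= size T by lia.
have szs := size_suf T hs.
have szS : size S = e.+1 - s by rewrite /S substr_suf // size_takel ?szs; lia.
have repS : (1 < freq T S) = (size S <= ell T i).
  by rewrite szS leq_ell ?szs /S ?substr_suf //; lia.
have uniq_right : (e = size T \/ freq T (substr T s e.+1) = 1) <->
    ell T i <= size S.
  have [E|ne] := eqVneq e (size T).
    split=> // _; last by left.
    by apply: leq_trans (ell_ISA_leq_size hsT) _; rewrite szs szS E.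
  (* The length [e.+2 - s] is [|S| + 1]. The extended string occurs at [s], so frequency 1 is the
     negation of frequency above 1. *)
  have ge1 := freq_gt0 hsT (prefix_take (suf T s) (e.+2 - s)).
  have := @leq_ell _ _ T s (e.+2 - s) hsT; rewrite szs -/i => H.
  rewrite substr_suf //; move: ge1 H; set f := freq _ _; lia.
have uniq_left : (s = 1 \/ freq T (substr T s.-1 e) = 1) <->
    ell T j <= size S.
  (* For [s = 1] both sides hold, since [j] takes the default value 1 and [ell] vanishes there. *)
  rewrite /j /LF SA_ISA //; case: ltnP => s1; last first.
    by rewrite ell1 //; split=> // _; left; lia.
  have hs' : 1 <= s.-1 <= size T by lia.
  have ge1 := freq_gt0 hs' (prefix_take (suf T s.-1) (e.+1 - s.-1)).
  have := @leq_ell _ _ T s.-1 (e.+1 - s.-1) hs'; rewrite size_suf => [H|]; last lia.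
  rewrite substr_suf; last by lia.
  move: ge1 H; set f := freq _ _; lia.
(* Repetition of [S] and uniqueness to the right are the two inequalities that make up
   [size S = ell T i]. *)
rewrite /net_occurrence -/S repS; split.
  by case=> _ H1 /uniq_left H2 /uniq_right H3; split=> //; lia.
case=> H1 H2; split; [lia|lia|exact/uniq_left|apply/uniq_right; lia].
Qed.
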